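(* Let $n \ge 1$, let $A_L, A_R \in \mathbb{R}^{n \times n}$ be matrices that differ only in their first columns, let $b \in \mathbb{R}^n$ and $\mu \in \mathbb{R}$, and consider the continuous piecewise-linear map $$g(x;\mu) = \begin{cases} A_L x + b \mu, & x_1 \le 0, \\ A_R x + b \mu, & x_1 \ge 0, \end{cases} \qquad x = (x_1,\ldots,x_n) \in \mathbb{R}^n .$$ If $\det(I - A_L) \ne 0$, $\det(I - A_R) \ne 0$, and both fixed points $x^L(\mu) = (I - A_L)^{-1} b \mu$ and $x^R(\mu) = (I - A_R)^{-1} b\mu$ of the two pieces of $g$ are virtual, then every forward orbit of $g(\cdot\,;\mu)$ diverges.
   Context: $I$ is the $n \times n$ identity matrix, and a subscript $1$ on a vector denotes its first component. The fixed point $x^L(\mu)$ of the left piece is called virtual if $x^L_1(\mu) > 0$ (and admissible if $x^L_1(\mu) < 0$); the fixed point $x^R(\mu)$ of the right piece is called virtual if $x^R_1(\mu) < 0$ (and admissible if $x^R_1(\mu) > 0$). A forward orbit is a sequence $x, g(x;\mu), g^2(x;\mu), \ldots$ with $x \in \mathbb{R}^n$; it diverges if $\| g^k(x;\mu) \| \to \infty$ as $k \to \infty$, where $\|\cdot\|$ is the Euclidean norm. *)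

(* Defs.v *)
From mathcomp Require Import all_boot all_order all_algebra.
From mathcomp Require Import all_classical all_reals all_analysis.

Set Implicit Arguments.
Unset Strict Implicit.
Unset Printing Implicit Defensive.

Import Order.TTheory GRing.Theory Num.Theory.
Import numFieldNormedType.Exports.

Local Open Scope classical_set_scope.
Local Open Scope ring_scope.

(* A dimension n >= 1 is written n.+1 throughout; vectors are column vectors,
   and the first component (resp. first column) has index ord0. *)

Definition fst_comp (R : realType) (n : nat) (x : 'cV[R]_n.+1) : R :=
  x ord0 ord0.

Definition differ_only_first_col (R : realType) (n : nat)
    (AL AR : 'M[R]_n.+1) : Prop :=
  forall i j : 'I_n.+1, j != ord0 -> AL i j = AR i j.

(* The two pieces overlap on x_1 = 0, where they agree when the matrices differ
   only in their first columns; see [pwl_map_le0] and [pwl_map_ge0]. *)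
Definition pwl_map (R : realType) (n : nat) (AL AR : 'M[R]_n.+1)
    (b : 'cV[R]_n.+1) (mu : R) (x : 'cV[R]_n.+1) : 'cV[R]_n.+1 :=
  if fst_comp x <= 0 then AL *m x + mu *: b else AR *m x + mu *: b.

(* Meaningful when \det (1%:M - A) != 0: for singular M, [invmx M] is M itself. *)
Definition piece_fixpoint (R : realType) (n : nat) (A : 'M[R]_n.+1)
    (b : 'cV[R]_n.+1) (mu : R) : 'cV[R]_n.+1 :=
  invmx (1%:M - A) *m (mu *: b).

Definition left_virtual (R : realType) (n : nat) (x : 'cV[R]_n.+1) : Prop :=
  0 < fst_comp x.

Definition right_virtual (R : realType) (n : nat) (x : 'cV[R]_n.+1) : Prop :=
  fst_comp x < 0.

(* The library's norm `|x| on matrices is the sup norm, hence this one. *)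
Definition euclidean_norm (R : realType) (n : nat) (x : 'cV[R]_n.+1) : R :=
  Num.sqrt (\sum_(i < n.+1) x i ord0 ^+ 2).

Definition forward_orbit (T : Type) (g : T -> T) (x : T) (k : nat) : T :=
  iter k g x.

Definition diverges (R : realType) (n : nat) (u : nat -> 'cV[R]_n.+1) : Prop :=
  euclidean_norm (u k) @[k --> \oo] --> +oo.

Lemma pwl_map_le0 (R : realType) (n : nat) (AL AR : 'M[R]_n.+1)
    (b : 'cV[R]_n.+1) (mu : R) (x : 'cV[R]_n.+1) :
  fst_comp x <= 0 -> pwl_map AL AR b mu x = AL *m x + mu *: b.
Proof. by rewrite /pwl_map => ->. Qed.

Lemma pwl_map_ge0 (R : realType) (n : nat) (AL AR : 'M[R]_n.+1)
    (b : 'cV[R]_n.+1) (mu : R) (x : 'cV[R]_n.+1) :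
  differ_only_first_col AL AR ->
  0 <= fst_comp x -> pwl_map AL AR b mu x = AR *m x + mu *: b.
Proof.
move=> dA x_ge0; rewrite /pwl_map; case: ifP => // x_le0; congr (_ + _).
have x0 : x ord0 ord0 = 0 by apply/eqP; rewrite eq_le; apply/andP; split.
apply/matrixP => i j; rewrite !mxE; apply: eq_bigr => k _; rewrite (ord1 j).
by case: (eqVneq k ord0) => [-> | /dA ->//]; rewrite x0 !mulr0.
Qed.

Lemma piece_fixpointP (R : realType) (n : nat) (A : 'M[R]_n.+1)
    (b : 'cV[R]_n.+1) (mu : R) :
  \det (1%:M - A) != 0 ->
  let x := piece_fixpoint A b mu in A *m x + mu *: b = x.
Proof.
move=> dA x; have uA : 1%:M - A \in unitmx by rewrite unitmxE unitfE.
have : (1%:M - A) *m x = mu *: b by rewrite /x /piece_fixpoint mulKVmx.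
by rewrite mulmxBl mul1mx => <-; rewrite addrC subrK.
Qed.

(* Main.v *)
(** Cofactors along the first column do not see that column, so the first rows
    of the adjugates of [I - A_L] and [I - A_R] coincide. Hence the row vector
    [p = e_1^T (I - A_L)^-1] satisfies both [p (I - A_L) = e_1^T] and
    [p (I - A_R) = r e_1^T], with [r = det (I - A_R) / det (I - A_L)]. It follows
    that [p b mu = x^L_1 = r x^R_1], so virtuality forces [x^L_1 > 0] and [r < 0].
    Since [p g(x) - p x] equals [x^L_1 - x_1] on the left and [x^L_1 - r x_1] on
    the right, [p x] grows by at least [x^L_1 > 0] at every step. *)
Require Import Defs.
From mathcomp Require Import all_boot all_order all_algebra.
From mathcomp Require Import all_classical all_reals all_analysis.

Import Order.TTheory GRing.Theory Num.Theory.
Import numFieldNormedType.Exports.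

Local Open Scope classical_set_scope.
Local Open Scope ring_scope.

Lemma row_adj_eq_off_col (R : comNzRingType) (n : nat) (M N : 'M[R]_n)
    (j0 : 'I_n) :
  (forall i j, j != j0 -> M i j = N i j) ->
  row j0 (\adj M) = row j0 (\adj N).
Proof.
move=> MN; apply/rowP => i; rewrite !mxE /cofactor; congr (_ * \det _).
by apply/matrixP => k l; rewrite !mxE MN // eq_sym neq_lift.
Qed.

Lemma row_adj_mul (R : comNzRingType) (n : nat) (M : 'M[R]_n) (i : 'I_n)
    (x : 'cV[R]_n) :
  (row i (\adj M) *m (M *m x)) 0 0 = \det M * x i 0.
Proof. by rewrite -row_mul mulmxA mul_adj_mx mul_scalar_mx !mxE. Qed.

Lemma le_euclidean_norm (R : realType) (n : nat) (x : 'cV[R]_n.+1)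
    (i : 'I_n.+1) :
  `|x i ord0| <= euclidean_norm x.
Proof.
rewrite -sqrtr_sqr ler_wsqrtr // (bigD1 i) //= lerDl.
by apply: sumr_ge0 => j _; exact: sqr_ge0.
Qed.

Lemma mulmx_le_euclidean_norm (R : realType) (n : nat) (p : 'rV[R]_n.+1)
    (x : 'cV[R]_n.+1) :
  (p *m x) 0 0 <= (\sum_i `|p 0 i|) * euclidean_norm x.
Proof.
rewrite mxE mulr_suml; apply: ler_sum => i _.
by rewrite (le_trans (ler_norm _))// normrM ler_wpM2l// le_euclidean_norm.
Qed.

(** A linear functional is at most a constant times the norm, so its unbounded growth along [u]
    forces the norm to infinity. *)
Lemma diverges_linear_growth (R : realType) (n : nat) (u : nat -> 'cV[R]_n.+1)
    (p : 'rV[R]_n.+1) (c : R) :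
  0 < c -> (forall k, (p *m u k) 0 0 + c <= (p *m u k.+1) 0 0) -> diverges u.
Proof.
(* The summand 1 makes [C] positive without showing [p] nonzero. *)
move=> c0 step; set C := 1 + \sum_i `|p 0 i|.
have C0 : 0 < C by rewrite ltr_pwDl// sumr_ge0.
have growth k : (p *m u 0%N) 0 0 + c * k%:R <= (p *m u k) 0 0.
  elim: k => [|k IHk]; first by rewrite mulr0 addr0.
  by rewrite -natr1 mulrDr mulr1 addrA (le_trans _ (step k))// lerD2r.
apply/cvgryPge => A.
(* Past this threshold, [A * C <= p u_0 + c k <= p u_k <= C * |u_k|]. *)
have := @cvgr_idn R; move/cvgryPge/(_ ((A * C - (p *m u 0%N) 0 0) / c)).
apply: filterS => k; rewrite ler_pdivrMr// lerBlDl [_ * c]mulrC => Ak.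
rewrite -(ler_pM2r C0) (le_trans Ak)// (le_trans (growth k))//.
rewrite (le_trans (mulmx_le_euclidean_norm _ _ _ _))// [leRHS]mulrC.
by rewrite ler_wpM2r ?sqrtr_ge0// lerDr.
Qed.

(** Around the fixed point [y], the piece maps [x] to [x + (I - A) (y - x)], and the adjugate row
    turns [I - A] into its determinant. *)
Lemma affine_step (R : realType) (n : nat) (A : 'M[R]_n.+1)
    (b : 'cV[R]_n.+1) (mu : R) (x : 'cV[R]_n.+1) :
  \det (1%:M - A) != 0 ->
  (row ord0 (\adj (1%:M - A)) *m (A *m x + mu *: b)) 0 0 =
  (row ord0 (\adj (1%:M - A)) *m x) 0 0 +
  \det (1%:M - A) * (fst_comp (piece_fixpoint A b mu) - fst_comp x).
Proof.
move=> dA; set y := piece_fixpoint A b mu.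
have -> : A *m x + mu *: b = x + (1%:M - A) *m (y - x).
  have mub : (1%:M - A) *m y = mu *: b by rewrite mulKVmx// unitmxE unitfE.
  by rewrite mulmxBr mub mulmxBl mul1mx opprB addrCA [x + _]addrC subrK addrC.
by rewrite mulmxDr [LHS]mxE row_adj_mul /fst_comp !mxE.
Qed.

Lemma det_mul_fst_fixpoint (R : realType) (n : nat) (A : 'M[R]_n.+1)
    (b : 'cV[R]_n.+1) (mu : R) :
  \det (1%:M - A) != 0 ->
  \det (1%:M - A) * fst_comp (piece_fixpoint A b mu) =
  (row ord0 (\adj (1%:M - A)) *m (mu *: b)) 0 0.
Proof.
by move=> dA; rewrite -row_adj_mul mulKVmx// unitmxE unitfE.
Qed.

Theorem theorem1 (R : realType) (n : nat) (AL AR : 'M[R]_n.+1)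
    (b : 'cV[R]_n.+1) (mu : R)
    (hA : differ_only_first_col AL AR)
    (hL : \det (1%:M - AL) != 0)
    (hR : \det (1%:M - AR) != 0)
    (hxL : left_virtual (piece_fixpoint AL b mu))
    (hxR : right_virtual (piece_fixpoint AR b mu)) :
  forall x : 'cV[R]_n.+1, diverges (forward_orbit (pwl_map AL AR b mu) x).
Proof.
move=> x; set xL := fst_comp (piece_fixpoint AL b mu).
set dL := \det (1%:M - AL) in hL *; set dR := \det (1%:M - AR) in hR *.
set q := row ord0 (\adj (1%:M - AL)).
have qR : row ord0 (\adj (1%:M - AR)) = q.
  by apply: row_adj_eq_off_col => i j j0; rewrite !mxE hA.
have dLR : dL * xL = dR * fst_comp (piece_fixpoint AR b mu).
  by rewrite !det_mul_fst_fixpoint// qR.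
(* By [dLR], this ratio times the negative [x^R_1] is [xL > 0]. *)
have r_lt0 : dL^-1 * dR < 0.
  rewrite -(nmulr_lgt0 _ hxR) -mulrA -dLR mulKf//; exact: hxL.
apply: (diverges_linear_growth _ _ _ (dL^-1 *: q) xL) => // k.
rewrite /forward_orbit iterS; set y := iter k _ x.
rewrite -!scalemxAl ![fun_of_matrix (_ *: _) _ _]mxE.
have [y_le0|y_gt0] := leP (fst_comp y) 0.
  by rewrite pwl_map_le0// affine_step// mulrDr mulKf// lerD2l lerBrDr gerDl.
(* [affine_step] needs the adjugate row of the right piece, hence the passage through [qR] and
   back. *)
rewrite (pwl_map_ge0 _ _ hA (ltW y_gt0)) -qR affine_step// qR mulrDr lerD2l.
by rewrite mulrBr -dLR mulrBr mulKf// mulrA lerBrDr gerDl nmulr_rle0 // ltW.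
Qed.
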